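(* Let $g \ge 3$ be an integer such that $$\left\lceil \frac{3+\sqrt{8g+1}}{2} \right\rceil = \left\lfloor \frac{7+\sqrt{32g-15}}{4} \right\rfloor .$$ Then $$|V|_{\min}(g) = 2\left\lceil \frac{3+\sqrt{8g+1}}{2} \right\rceil ,$$ where $|V|_{\min}(g)$ is the smallest number of vertices of a quadrangulation on the closed orientable 2-manifold $\Sigma_g$ of genus $g$.
   Context: Graphs are finite and simple (no loops; any two vertices are joined by at most one edge). $\Sigma_g$ denotes the closed (connected) orientable 2-manifold of genus $g$. A polyhedron $G \hookrightarrow \Sigma_g$ with 1-skeleton $G$ is a cellular embedding of the connected graph $G$ in $\Sigma_g$, i.e. every component (face, region) of the complement of $G$ in $\Sigma_g$ is an open disk. It is called a quadrangulation on $\Sigma_g$ if each face is bounded by a cycle of four edges in $G$. No further condition is imposed on how distinct faces intersect. A quadrangulation on $\Sigma_g$ is minimal for $\Sigma_g$ if no quadrangulation on $\Sigma_g$ has fewer vertices, and $|V|_{\min}(g)$ denotes the number of vertices in a minimal quadrangulation on $\Sigma_g$. *)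

(* Defs.v *)
From mathcomp Require Import all_boot all_order all_algebra all_fingroup.

Set Implicit Arguments.
Unset Strict Implicit.
Unset Printing Implicit Defensive.

Import GRing.Theory.
Local Open Scope ring_scope.

(* A cellular embedding of a connected simple graph in an oriented closed     *)
(* surface is given by its rotation system (Heffter, Edmonds, Ringel): at     *)
(* each vertex v, the cyclic order pe_rot v in which the orientation meets    *)
(* the edges at v. The graph is simple, so an edge at v is identified with    *)
(* its other end and pe_rot v permutes the neighbours of v in a single cycle. *)
Record polyhedron (T : finType) := Polyhedron {
  pe_adj :> rel T;
  pe_sym : symmetric pe_adj;
  pe_irr : irreflexive pe_adj;
  pe_nonempty : (0 < #|T|)%N;
  pe_connected : forall x y : T, connect pe_adj x y;
  pe_rot : T -> {perm T};
  pe_rot_on : forall v : T, perm_on [set w | pe_adj v w] (pe_rot v);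
  pe_rot_cycle : forall v w : T,
    pe_adj v w -> porbit (pe_rot v) w = [set w' | pe_adj v w']
}.

Section Polyhedron.
Variables (T : finType) (G : polyhedron T).

Definition arcs : {set T * T} := [set a | G a.1 a.2].

Definition edges : {set {set T}} := [set [set a.1; a.2] | a in arcs].

(* Walking along the boundary of a face: after the arc from u to v comes the  *)
(* arc leaving v that follows, in the rotation at v, the edge back to u.      *)
(* This map is injective on T * T and maps arcs to arcs.                      *)
Definition face_step (a : T * T) : T * T := (a.2, pe_rot G a.2 a.1).

(* Each face is recorded as the set of arcs of its boundary walk. The graph   *)
(* with one vertex has no arc, so its face in the sphere is not recorded; it  *)
(* is not a quadrangulation, and it satisfies has_genus g for no g.           *)
Definition faces : {set {set T * T}} :=
  [set [set b | fconnect face_step a b] | a in arcs].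

Definition euler_char : int := #|T|%:Z - #|edges|%:Z + #|faces|%:Z.

(* The closed orientable surface of genus g is the one with Euler             *)
(* characteristic 2 - 2g.                                                     *)
Definition has_genus (g : nat) : Prop := euler_char = 2 - 2 * g%:Z.

(* The boundary walk of the face on whose boundary the arc a lies runs once   *)
(* through four distinct vertices, that is, around a cycle of four edges.     *)
Definition four_cycle_face (a : T * T) : bool :=
  (fingraph.order face_step a == 4)%N &&
  uniq [seq b.1 | b <- fingraph.orbit face_step a].

Definition quadrangulation (g : nat) : Prop :=
  has_genus g /\ {in arcs, forall a, four_cycle_face a}.

End Polyhedron.

Definition minimal_quadrangulation (g : nat) (T : finType) (G : polyhedron T) :
    Prop :=
  quadrangulation G g /\
  forall (T' : finType) (G' : polyhedron T'),
    quadrangulation G' g -> (#|T| <= #|T'|)%N.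

(* N is |V|_min(g); the relational form includes the existence of a           *)
(* quadrangulation, and N is unique by minimality.                            *)
Definition is_min_vertices (g : nat) (N : int) : Prop :=
  exists (T : finType) (G : polyhedron T),
    minimal_quadrangulation g G /\ #|T|%:Z = N.

(* Main.v *)
(* Upper bound: let H be a connected graph with m >= 2 vertices and Betti     *)
(* number g. Replace every vertex v by two copies v+ and v-, joined to both   *)
(* copies of each neighbour of v. If the neighbours of v are w1, ..., wd in   *)
(* some cyclic order, let the rotation at v+ be w1+ w1- w2+ w2- ... wd+ wd-,  *)
(* and the one at v- its reverse. The faces are then the 4-cycles             *)
(* v+ wi- v- w(i+1)+, one for each corner of H; this is the boundary of a     *)
(* thickening of H in space, so it has genus g. Such an H, a star with g      *)
(* further edges, exists if and only if g <= (m-1)(m-2)/2, which is the       *)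
(* inequality m >= (3 + sqrt (8g + 1)) / 2.                                   *)
(* Lower bound: Euler's formula gives 2(V + 2g - 2) edges, at most V(V-1)/2   *)
(* in a simple graph; by m <= (7 + sqrt (32g - 15)) / 4 this excludes V < 2m. *)

Require Import Defs.
From mathcomp Require Import all_boot all_order all_algebra all_fingroup.
From mathcomp Require Import reals zify lra.

Import Order.TTheory GRing.Theory Num.Theory.
Local Open Scope ring_scope.

(** Both bounds come from counting arcs. In a quadrangulation an edge carries two arcs and a face
    four, so Euler's formula for V vertices and A arcs reads A + 8 = 4V + 8g ([has_genus_arcs]). As
    A <= V(V-1), this forces 8g <= V^2 - 5V + 8 ([quadrangulation_card_ge]). Conversely, the
    doubling of a graph H has only 4-cycle faces ([doubling_four_cycle]), two vertices per vertex
    and four arcs per arc of H, so the same identity gives it the Betti number of H as genus;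
    [exists_quadrangulation] applies this to a star with g edges added between its leaves. The
    hypothesis provides one integer m for both sides: its ceiling form yields g <= C(m-1, 2), so 2m
    vertices suffice, and its floor form rules out fewer. *)

(** * Counting arcs by edges and by faces *)

Lemma card_imset_uniform (I J : finType) (h : I -> J) (A : {set I}) (k : nat) :
  (forall a, a \in A -> #|[set b in A | h b == h a]| = k) ->
  #|A| = (#|h @: A| * k)%N.
Proof.
move=> hk; rewrite -sum1_card (partition_big_imset h) /= -sum_nat_const.
apply: eq_bigr => _ /imsetP[a aA ->]; rewrite -(hk a aA) -sum1_card.
by apply: eq_bigl => b; rewrite inE.
Qed.

Lemma set2_eq (T : finType) (x y z t : T) :
  ([set x; y] == [set z; t]) = ((x, y) \in [set (z, t); (t, z)]).
Proof.
rewrite !inE !xpair_eqE; apply/eqP/idP => [E|]; last first.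
  by case/orP => /andP[/eqP-> /eqP->]; rewrite // setUC.
have xE : x \in [set z; t] by rewrite -E set21.
have yE : y \in [set z; t] by rewrite -E set22.
have : z \in [set x; y] by rewrite E set21.
have : t \in [set x; y] by rewrite E set22.
by move: xE yE; rewrite !inE => /orP[] /eqP-> /orP[] /eqP->;
  rewrite ?eqxx ?orbT // ?orbb => tz zt;
  first [rewrite (eqP tz) | rewrite (eqP zt)]; rewrite !eqxx.
Qed.

Lemma card_arcs_edges (T : finType) (r : rel T) :
    symmetric r -> irreflexive r ->
  let A := [set a : T * T | r a.1 a.2] in
  #|A| = (#|[set [set a.1; a.2] | a in A]| * 2)%N.
Proof.
move=> rS rI A; apply: card_imset_uniform => -[x y]; rewrite inE /= => rxy.
have nxy : (x, y) != (y, x).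
  by rewrite xpair_eqE; case: eqP rxy => //= ->; rewrite rI.
rewrite -[RHS](congr1 succn (congr1 nat_of_bool nxy)) -cards2.
congr #|pred_of_set _|; apply/setP => -[z t]; rewrite inE /= set2_eq inE /=.
by rewrite !inE; case: eqP => [[-> ->]|_]; [rewrite rxy|
  case: eqP => [[-> ->]|_]; rewrite ?andbF // rS rxy].
Qed.

Section Polyhedra.
Variables (T : finType) (G : polyhedron T).

Lemma face_step_inj : injective (face_step G).
Proof. by move=> [a b] [c d] [<-] /perm_inj ->. Qed.

Lemma face_stepP a : (face_step G a \in arcs G) = (a \in arcs G).
Proof.
case: a => a b; rewrite !inE /= [RHS]pe_sym.
by have /(perm_closed a) := pe_rot_on G b; rewrite !inE.
Qed.

(** The fibre over a face is one orbit of [face_step], of size 4 by assumption; it stays inside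
    [arcs G] by [face_stepP]. *)
Lemma card_arcs_face : {in arcs G, forall a, four_cycle_face G a} ->
  #|arcs G| = (#|faces G| * 4)%N.
Proof.
move=> hG; apply: card_imset_uniform => a aA.
case/andP: (hG a aA) => /eqP <- _; rewrite /fingraph.order.
have sy := fconnect_sym face_step_inj.
apply: eq_card => b; rewrite !inE.
apply/andP/idP => [[_ /eqP/setP/(_ b)]|ab].
  by rewrite !inE connect0 => <-.
split; last by apply/eqP/setP => c; rewrite !inE; apply/esym/same_connect.
have := closed_connect (e := frel (face_step G)) (a := mem (arcs G)) _ ab.
rewrite !inE in aA * => <- // c d /eqP <-; exact/esym/face_stepP.
Qed.

End Polyhedra.

(** * The doubled graph and its rotation system *)

Section Doubling.
Variables (T : finType) (e : rel T).
Hypotheses (eS : symmetric e) (eI : irreflexive e).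
Hypotheses (T0 : (0 < #|T|)%N) (eC : forall x y, connect e x y).
Hypothesis eN : forall x, exists y, e x y.

Definition turn (b : bool) (v : T) : T -> T :=
  (if b then @next T else @prev T) (enum (e v)).
Arguments turn : simpl never.

Lemma turnK b v : cancel (turn b v) (turn (~~ b) v).
Proof. by case: b; [apply: prev_next|apply: next_prev]; apply: enum_uniq. Qed.

Lemma turn_adj b v w : e v (turn b v w) = e v w.
Proof.
by rewrite -[LHS]mem_enum -[RHS]mem_enum; case: b; rewrite ?mem_next ?mem_prev.
Qed.

Lemma turn_connect b v w w' : e v w -> e v w' -> fconnect (turn b v) w w'.
Proof.
have cyc : fcycle (turn true v) (enum (e v)) := cycle_next (enum_uniq _).
have tr u u' : e v u -> e v u' -> fconnect (turn true v) u u'.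
  by move=> vu vu'; rewrite (fconnect_cycle cyc) mem_enum.
case: b => vw vw'; first exact: tr.
(* The backward turn has the forward turn as its inverse, hence the same orbits. *)
rewrite -(same_fconnect_finv (can_inj (turnK false v))).
rewrite (@eq_fconnect _ _ (turn true v)) ?tr // => u.
by rewrite -{1}[u](turnK true v) finv_f //; apply: can_inj (turnK false v).
Qed.

Definition dbl_adj : rel (T * bool) := fun x y => e x.1 y.1.

(* Copies [true] and [false] of v are v+ and v-. At v+, wi+ is followed by    *)
(* wi- and wi- by w(i+1)+; at v-, wi- by wi+ and wi+ by w(i-1)-.              *)
Definition dbl_turn (x y : T * bool) : T * bool :=
  if ~~ e x.1 y.1 then y else
  if x.2 == y.2 then (y.1, ~~ y.2) else (turn x.2 x.1 y.1, x.2).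

Lemma dbl_turn_inj x : injective (dbl_turn x).
Proof.
pose f y := if ~~ e x.1 y.1 then y else
  if x.2 == y.2 then (turn (~~ x.2) x.1 y.1, ~~ x.2) else (y.1, x.2).
apply: (can_inj (g := f)) => -[w c]; rewrite /dbl_turn /f /=.
case xw: (e x.1 w) => /=; last by rewrite xw.
case: eqP => [->|/eqP]; first by rewrite /= xw; case: c.
by rewrite /= turn_adj xw eqxx turnK; case: x.2 c => -[].
Qed.

Definition dbl_rot x : {perm T * bool} := perm (@dbl_turn_inj x).

Lemma dbl_sym : symmetric dbl_adj. Proof. by move=> x y; apply: eS. Qed.

Lemma dbl_irr : irreflexive dbl_adj. Proof. by move=> x; apply: eI. Qed.

Lemma dbl_nonempty : (0 < #|{: T * bool}|)%N.
Proof. by rewrite card_prod card_bool muln_gt0 T0. Qed.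

(** Paths lift to either sign. The two copies of a vertex are not adjacent, so they are linked
    through a neighbour, which [eN] supplies. *)
Lemma dbl_connected x y : connect dbl_adj x y.
Proof.
have lift c u v : connect e u v -> connect dbl_adj (u, c) (v, c).
  case/connectP => p; elim: p u => [|w p IHp] u /= => [_ ->|].
    exact: connect0.
  case/andP => uw wp vE; apply: connect_trans (IHp w wp vE).
  exact: connect1.
case: x y => u c [v d]; apply: connect_trans (lift c _ _ (eC u v)) _.
have [w vw] := eN v; apply: (@connect_trans _ _ (w, true));
  apply: connect1 => //.
by rewrite dbl_sym.
Qed.

Lemma dbl_rot_on x : perm_on [set y | dbl_adj x y] (dbl_rot x).
Proof.
apply/subsetP => y; rewrite !inE permE /dbl_turn /dbl_adj.
by case: (e _ _); rewrite ?eqxx.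
Qed.

(** An orbit containing one copy of a neighbour contains the other ([orb]) and passes on to the next
    neighbour ([step]); [turn_connect] then reaches all neighbours. *)
Lemma dbl_rot_cycle x y :
  dbl_adj x y -> porbit (dbl_rot x) y = [set z | dbl_adj x z].
Proof.
rewrite /dbl_adj => xy.
have flip z : e x.1 z -> (z, ~~ x.2) \in porbit (dbl_rot x) (z, x.2).
  move=> xz; rewrite -[(z, ~~ _)](_ : dbl_rot x (z, x.2) = _).
    exact: (mem_porbit _ 1).
  by rewrite permE /dbl_turn xz /= eqxx.
have orb z c : e x.1 z ->
    porbit (dbl_rot x) (z, c) = porbit (dbl_rot x) (z, x.2).
  move=> xz; have [->//|] := eqVneq c x.2; rewrite -[c == _]negbK => ncx.
  have -> : c = ~~ x.2 by case: c x.2 ncx => -[].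
  by apply/eqP; rewrite eq_porbit_mem flip.
have step z : e x.1 z ->
    porbit (dbl_rot x) (turn x.2 x.1 z, x.2) = porbit (dbl_rot x) (z, x.2).
  move=> xz; rewrite -(orb z (~~ x.2)) //; apply/eqP.
  rewrite eq_porbit_mem.
  rewrite -[(turn _ _ _, _)](_ : dbl_rot x (z, ~~ x.2) = _).
    exact: (mem_porbit _ 1).
  by rewrite permE /dbl_turn xz /=; case: x.2.
have adjP z : e x.1 z -> porbit (dbl_rot x) (z, x.2) = porbit (dbl_rot x) y.
  move=> xz; case: y xy => y c /= xy; rewrite (orb y) //.
  have /iter_findex <- := turn_connect x.2 _ _ _ xy xz.
  elim: (findex _ _ _) => //= n IHn; rewrite step //.
  by elim: {IHn} n => //= n; rewrite turn_adj.
apply/setP => -[z c]; rewrite inE /=; apply/idP/idP => [|xz]; last first.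
  by rewrite -(adjP z xz) -(orb z c) // porbit_id.
case/porbitP => i; elim: i z c => [|i IHi] z c.
  by rewrite expg0 perm1 => yE; rewrite -yE in xy.
rewrite expgSr permM permE /dbl_turn.
case yE: ((dbl_rot x ^+ i)%g y) => [u d] /=.
have xu : e x.1 u by apply: IHi; rewrite yE.
by rewrite xu /=; case: eqP => _ [-> _] //; rewrite turn_adj.
Qed.

Definition doubling : polyhedron (T * bool)%type :=
  Polyhedron dbl_sym dbl_irr dbl_nonempty dbl_connected dbl_rot_on dbl_rot_cycle.

Lemma doubling_four_cycle :
  {in arcs doubling, forall a, four_cycle_face doubling a}.
Proof.
(* Distinct sources are needed here: returning after four steps alone allows a period of 1 or 2. *)
have four a : iter 4 (face_step doubling) a = a ->
    uniq [seq b.1 | b <- traject (face_step doubling) a 4] ->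
    four_cycle_face doubling a.
  move=> a4 Ua; have ord : fingraph.order (face_step doubling) a = 4%N.
    rewrite (@order_cycle _ _ (traject (face_step doubling) a 4)) //.
    - by rewrite /= !eqxx andbT; apply/eqP; apply: a4.
    - exact: map_uniq Ua.
    by rewrite inE eqxx.
  by rewrite /four_cycle_face /fingraph.orbit ord eqxx.
have rotE v d u c : e v u ->
    dbl_rot (v, d) (u, c) = if d == c then (u, ~~ c) else (turn d v u, d).
  by move=> vu; rewrite permE /dbl_turn /= vu.
have ne w w' : e w w' -> (w == w') = false.
  by case: eqP => // ->; rewrite eI.
move=> [[u c] [v d]]; rewrite inE /= /dbl_adj /= => uv.
have vu : e v u by rewrite eS.
have vt b : e v (turn b v u) by rewrite turn_adj.
have ut b : e u (turn b u v) by rewrite turn_adj.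
have tv b : e (turn b v u) v by rewrite eS.
have tu b : e (turn b u v) u by rewrite eS.
have tK b v' w : turn (~~ b) v' (turn b v' w) = w by rewrite turnK.
(* Two opposite corners of the face are the copies of one vertex; the other two are neighbours of it
   with opposite signs, hence distinct even when that vertex has degree one. *)
apply: four; rewrite /face_step /=; case: c d => -[].
all: by rewrite !rotE //= ?(tK true) ?(tK false) //
  !inE !xpair_eqE /= ?andbF ?andbT ?orbF ?ne.
Qed.

End Doubling.

(** * Euler's formula and the lower bound *)

Lemma has_genus_arcs (T : finType) (G : polyhedron T) (g : nat) :
  {in arcs G, forall a, four_cycle_face G a} ->
  has_genus G g <-> (#|arcs G| + 8 = 4 * #|T| + 8 * g)%N.
Proof.
move=> hG; have := card_arcs_face _ G hG.
have := card_arcs_edges _ _ (pe_sym G) (pe_irr G).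
rewrite /= -/(arcs G) -/(edges G) /has_genus /euler_char.
move: #|arcs G| #|T| #|edges G| #|faces G| => a v n f aE aF; split; lia.
Qed.

Lemma card_arcs_le (T : finType) (r : rel T) : irreflexive r ->
  (#|[set a : T * T | r a.1 a.2]| + #|T| <= #|T| ^ 2)%N.
Proof.
move=> rI; set A := [set a | _].
have diag_inj : injective (fun x : T => (x, x)) by move=> x y [].
rewrite expnS expn1 -card_prod -{1}(card_imset _ diag_inj) -cardsUI.
rewrite [#|_ :&: _|]eq_card0 ?addn0 ?max_card // => -[x y].
rewrite !inE /=; apply/andP => -[rxy /imsetP[z _ [xz yz]]].
by move: rxy; rewrite xz yz rI.
Qed.

Lemma quadrangulation_card_ge (T : finType) (G : polyhedron T) (g : nat) :
  quadrangulation G g -> (5 * #|T| + 8 * g <= #|T| ^ 2 + 8)%N.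
Proof.
case=> hg hG; have := card_arcs_le _ _ (pe_irr G).
move/(has_genus_arcs _ _ _ hG): hg.
by rewrite -/(arcs G); move: #|arcs G| #|T| => a v; lia.
Qed.

(** * Base graphs with prescribed Betti number *)

Lemma exists_graph_arcs (T : finType) (g : nat) : (g <= 'C(#|T|, 2))%N ->
  exists e : rel T, [/\ symmetric e, irreflexive e &
    #|[set a : T * T | e a.1 a.2]| = (g * 2)%N].
Proof.
move=> gle.
have [S S2 Sg] : exists2 S : {set {set T}},
    {in S, forall B : {set T}, #|B| == 2%N} & #|S| = g.
  pose P := [set B : {set T} | #|B| == 2%N].
  exists [set B in take g (enum P)] => [B|].
    by rewrite inE => /mem_take; rewrite mem_enum inE.
  rewrite cardsE (card_uniqP (take_uniq _ (enum_uniq _))) size_takel //.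
  by rewrite -cardE card_draws.
pose e x y := [set x; y] \in S; exists e.
have eS : symmetric e by move=> x y; rewrite /e setUC.
have eI : irreflexive e.
  by move=> x; apply/negP => /S2; rewrite setUid cards1.
split => //; rewrite card_arcs_edges // -Sg; congr (#|pred_of_set _| * _)%N.
apply/setP => B; apply/imsetP/idP => [[a] + ->|BS]; first by rewrite inE.
have /cards2P[x [y [_ BE]]] := S2 B BS.
by exists (x, y); rewrite // inE /= /e -BE.
Qed.

Lemma card_rel_sum (T : finType) (r : rel T) :
  #|[set a : T * T | r a.1 a.2]| = (\sum_x \sum_y r x y)%N.
Proof.
rewrite pair_bigA -sum1dep_card [LHS]big_mkcond /=.
by apply: eq_bigr => a _; case: (r _ _).
Qed.

Lemma sum_option (T : finType) (F : option T -> nat) :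
  (\sum_x F x = F None + \sum_x F (Some x))%N.
Proof.
rewrite (bigD1 None) //=; congr addn.
rewrite (reindex_omap Some id) => [|[x|] //].
by apply: eq_bigl => x; rewrite /= eqxx.
Qed.

Lemma sum_pair_bool (T : finType) (F : T -> nat) :
  (\sum_(x : T * bool) F x.1 = 2 * \sum_x F x)%N.
Proof.
rewrite -(pair_bigA _ (fun x (_ : bool) => F x)) big_distrr /=.
by apply: eq_bigr => x _; rewrite sum_nat_const card_bool.
Qed.

Definition cone (T : finType) (e : rel T) : rel (option T) := fun x y =>
  match x, y with
  | Some i, Some j => e i j
  | None, None => false
  | _, _ => true
  end.

Lemma card_cone_arcs (T : finType) (e : rel T) :
  #|[set a : option T * option T | cone T e a.1 a.2]| =
  (#|T| * 2 + #|[set a : T * T | e a.1 a.2]|)%N.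
Proof.
rewrite !card_rel_sum sum_option sum_option /= add0n.
under [X in (_ + X)%N]eq_bigr => x _ do rewrite sum_option /=.
by rewrite big_split /= !sum1_card addnA muln2 addnn.
Qed.


(** The cone over a graph with k vertices and g edges has k + 1 vertices and k + g edges, hence
    Betti number g; its apex makes it connected. *)
Lemma exists_quadrangulation (k g : nat) : (0 < k)%N -> (g <= 'C(k, 2))%N ->
  exists (T : finType) (G : polyhedron T),
    quadrangulation G g /\ #|T| = (2 * k.+1)%N.
Proof.
move=> k0; rewrite -{1}[k]card_ord => /exists_graph_arcs[e [eS eI eg]].
pose c := cone _ e.
have cS : symmetric c by move=> [i|] [j|] //=; apply: eS.
have cI : irreflexive c by move=> [i|] //=; apply: eI.
have c0 : (0 < #|{: option 'I_k}|)%N by rewrite card_option.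
have cN x : exists y, c x y.
  by case: x => [i|]; [exists None|exists (Some (Ordinal k0))].
have cC x y : connect c x y.
  apply: (@connect_trans _ _ None).
    by case: x => [i|] //; apply: connect1.
  by case: y => [i|] //; apply: connect1.
pose G := doubling _ c cS cI c0 cC cN; exists _, G.
have hG := doubling_four_cycle _ c cS cI c0 cC cN.
split; last by rewrite card_prod card_bool card_option card_ord mulnC.
split=> //; apply/(has_genus_arcs _ _ _ hG).
rewrite (_ : #|arcs G| = (2 * (2 * #|[set a | c a.1 a.2]|))%N); last first.
  rewrite !card_rel_sum -sum_pair_bool big_distrr /=; apply: eq_bigr => x _.
  exact: (sum_pair_bool _ (fun y => c x.1 y : nat)).
rewrite card_cone_arcs eg card_prod card_bool card_option card_ord; lia.
Qed.

Theorem theorem1p1 (R : realType) (g : nat) (hg : (3 <= g)%N)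
    (hceil : Num.ceil ((3 + Num.sqrt (8 * g%:R + 1)) / 2 : R) =
             Num.floor ((7 + Num.sqrt (32 * g%:R - 15)) / 4 : R)) :
  is_min_vertices g (2 * Num.ceil ((3 + Num.sqrt (8 * g%:R + 1)) / 2 : R)).
Proof.
set s := Num.sqrt _ in hceil *; set t := Num.sqrt _ in hceil.
have g3 : 3 <= g%:R :> R by rewrite ler_nat.
have s0 : 0 <= s := sqrtr_ge0 _.
have sE : s ^+ 2 = 8 * g%:R + 1 by rewrite sqr_sqrtr //; lra.
have t0 : 0 <= t := sqrtr_ge0 _.
have tE : t ^+ 2 = 32 * g%:R - 15 by rewrite sqr_sqrtr //; lra.
have := ceil_ge ((3 + s) / 2); have := floor_le ((7 + t) / 4).
rewrite -hceil; case: (Num.ceil _) => [m|m] hm mh; last first.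
  by have : (Negz m)%:~R < 0 :> R; [rewrite ltrz0|lra].
rewrite -![(Posz m)%:~R]/(m%:R) in hm mh.
(* From g >= 3, s^2 >= 25. Then m >= 4 makes 4m - 7 positive, so that 4m - 7 <= t may be squared to
   get [hi]. *)
have s5 : 5 <= s by nra.
have m4 : 4 <= m%:R :> R by lra.
have lo : (8 * g + 1 + 12 * m <= 4 * (m * m) + 9)%N.
  by rewrite -(ler_nat R) !natrD !natrM; nra.
have hi : (16 * (m * m) + 64 <= 32 * g + 56 * m)%N.
  by rewrite -(ler_nat R) !natrD !natrM; nra.
move: m4; rewrite (ler_nat R 4) => m4 {hm mh hceil}.
have gle : (g <= 'C(m.-1, 2))%N 
  by rewrite bin2 geq_half_double; case: m m4 lo {hi} => [|[|m]] //= _; nia.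
have [|T [G [qG cT]]] := exists_quadrangulation m.-1 g _ gle; first by lia.
rewrite prednK in cT; last by lia.
exists T, G; split; last by rewrite cT.
(* If V <= 2m - 1, then V^2 - 5V + 8 <= 4m^2 - 14m + 14, whereas [hi] says 8g >= 4m^2 - 14m + 16. *)
split=> // T' G' /quadrangulation_card_ge; rewrite cT; nia.
Qed.
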